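(* Let $(G,B,m,w)$ be a weighted finite graph with boundary. Then $$\mu_i\le\mu_{i+j}(\Omega)+\operatorname{Deg}_B^{(|\Omega|-j)}$$ for $i=1,2,\dots,|\Omega|$ and $j=0,1,\dots,|\Omega|-i$.
   Context: A weighted finite graph $(G,m,w)$ is a finite simple graph $G$ with vertex set $V$ and edge set $E$, a vertex-measure $m:V\to(0,\infty)$ and an edge-weight $w:E\to(0,\infty)$; $w$ is extended to a symmetric function on $V\times V$ by $w_{xy}=0$ when $\{x,y\}\notin E$. A weighted finite graph with boundary $(G,B,m,w)$ is a weighted finite graph with a nonempty subset $B\subset V$ (the boundary); $\Omega=V\setminus B$ is the interior. $\mathbb{R}^S$ is the space of real functions on $S$, with inner product $\langle u,v\rangle_S=\sum_{x\in S}u(x)v(x)m_x$. Laplacian: $\Delta u(x)=\frac1{m_x}\sum_{y\in V}(u(x)-u(y))w_{xy}$ for $u\in\mathbb{R}^V$; its eigenvalues, counted with multiplicity, are $0=\mu_1\le\mu_2\le\dots\le\mu_{|V|}$. Laplacian of the interior subgraph: $\Delta_\Omega u(x)=\frac1{m_x}\sum_{y\in\Omega}(u(x)-u(y))w_{xy}$ for $u\in\mathbb{R}^\Omega$, with eigenvalues, counted with multiplicity, $0=\mu_1(\Omega)\le\dots\le\mu_{|\Omega|}(\Omega)$. For $x\in\Omega$, $\operatorname{Deg}_B(x)=\frac1{m_x}\sum_{y\in B}w_{xy}$, and $\operatorname{Deg}_B^{(1)}\le\dots\le\operatorname{Deg}_B^{(|\Omega|)}$ is the nondecreasing rearrangement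 of the values $\operatorname{Deg}_B(x)$, $x\in\Omega$. *)

(* Defs.v *)
From HB Require Import structures.
From mathcomp Require Import all_boot all_order all_algebra.
From mathcomp Require Import boolp classical_sets reals.
From mathcomp Require Import polyrcf.

Set Implicit Arguments.
Unset Strict Implicit.
Unset Printing Implicit Defensive.

Import Order.TTheory GRing.Theory Num.Theory.
Import passmx.

Local Open Scope ring_scope.

(* The edge-weight is stored in its extended form, a symmetric function on     *)
(* all pairs of vertices that vanishes off the edges.                          *)
Record weightedGraph (R : realType) := WeightedGraph {
  vertex :> finType;
  edge : rel vertex;
  edge_sym : symmetric edge;
  edge_irr : irreflexive edge;
  vmeasure : vertex -> R;
  vmeasure_gt0 : forall x, 0 < vmeasure x;
  weight : vertex -> vertex -> R;
  weight_sym : forall x y, weight x y = weight y x;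
  weight_gt0 : forall x y, edge x y -> 0 < weight x y;
  weight_eq0 : forall x y, ~~ edge x y -> weight x y = 0
}.

Record weightedGraphWithBoundary (R : realType) := WeightedGraphWithBoundary {
  wgraph :> weightedGraph R;
  boundary : {set wgraph};
  boundary_neq0 : boundary != finset.set0
}.

Section InducedSubgraph.
Variables (R : realType) (G : weightedGraph R) (S : {set G}).

Definition induced_subgraph : weightedGraph R :=
  @WeightedGraph R {x : G | x \in S}
    (fun x y => edge (val x) (val y))
    (fun x y => edge_sym (val x) (val y))
    (fun x => edge_irr (val x))
    (fun x => vmeasure (val x))
    (fun x => vmeasure_gt0 (val x))
    (fun x y => weight (val x) (val y))
    (fun x y => weight_sym (val x) (val y))
    (fun x y => @weight_gt0 R G (val x) (val y))
    (fun x y => @weight_eq0 R G (val x) (val y)).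

End InducedSubgraph.

Section Laplacian.
Variables (R : realType) (G : weightedGraph R).

Definition laplacian_fun (u : {ffun G -> R^o}) : {ffun G -> R^o} :=
  [ffun x => (vmeasure x)^-1 * \sum_(y : G) (u x - u y) * weight x y].

Fact laplacian_fun_linear : linear laplacian_fun.
Proof.
move=> a u v; apply/ffunP=> x; rewrite !ffunE /GRing.scale /= mulrCA -mulrDr.
congr (_ * _); rewrite mulr_sumr -big_split /=; apply: eq_bigr => y _.
by rewrite !ffunE /GRing.scale /= mulrA -mulrDl mulrBr opprD addrACA.
Qed.

HB.instance Definition _ := GRing.isLinear.Build R {ffun G -> R^o}
  {ffun G -> R^o} _ laplacian_fun laplacian_fun_linear.

Definition laplacian : 'End({ffun G -> R^o}) := linfun laplacian_fun.

Lemma laplacianE (u : {ffun G -> R^o}) x :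
  laplacian u x = (vmeasure x)^-1 * \sum_(y : G) (u x - u y) * weight x y.
Proof. by rewrite lfunE /= ffunE. Qed.

End Laplacian.

Section Eigenvalues.
Variables (R : realType) (vT : vectType R).
Implicit Types f : 'End(vT).

(* The nondecreasing list of the eigenvalues of f, each one repeated as many   *)
(* times as the dimension of its eigenspace; [eigenvaluesP] and                *)
(* [eigenvalues_unique] show that these conditions determine the list.         *)
Definition eigenvalues f : seq R :=
  xget [::] [set s : seq R | sorted <=%R s /\
                  forall a, count_mem a s = \dim (leigenspace f a)]%classic.

Lemma eigenvaluesP f : sorted <=%R (eigenvalues f) /\
  forall a, count_mem a (eigenvalues f) = \dim (leigenspace f a).
Proof.
apply: (@xgetPex _ [::] [set s : seq R | sorted <=%R s /\
  forall a, count_mem a s = \dim (leigenspace f a)]%classic).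
pose e : (\dim {:vT}).-tuple vT := vbasis fullv.
have eb : basis_of fullv e by exact: vbasisP.
pose p := char_poly (mxof e e f).
have p0 : p != 0 by rewrite monic_neq0// char_poly_monic.
pose s := flatten [seq nseq (\dim (leigenspace f a)) a | a <- rootsR p].
exists (sort <=%R s); split; first exact: sort_le_sorted.
move=> a; rewrite (permP (permEl (perm_sort _ _))) /s count_flatten -map_comp.
rewrite sumnE big_map (eq_bigr (fun b => (b == a) * \dim (leigenspace f a))%N).
  have [ap|aNp] := boolP (a \in rootsR p).
    rewrite (bigD1_seq a)//=; last exact: uniq_roots.
    by rewrite eqxx mul1n big1 ?addn0// => b /negPf->.
  rewrite big_seq big1 => [|b bp]; last first.
    by case: eqVneq => // ba; rewrite -ba bp in aNp.
  apply/esym/eqP; rewrite dimv_eq0; apply: contraNT aNp => fa0.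
  rewrite -(roots_on_rootsR p0) in_itv /= -eigenvalue_root_char.
  apply: contraNN fa0 => /eqP E.
  by rewrite (leigenspaceE eb) E vsof_eq0.
by move=> b _; rewrite /= count_nseq /=; case: eqVneq => // ->.
Qed.

Lemma eigenvalues_unique f (s : seq R) : sorted <=%R s ->
  (forall a, count_mem a s = \dim (leigenspace f a)) -> s = eigenvalues f.
Proof.
have [es ec] := eigenvaluesP f => ss sc; apply: le_sorted_eq => //.
by apply/allP => a _ /=; rewrite sc ec.
Qed.

(* Numbered from 1. *)
Definition eigenvalue_nth f (k : nat) : R := (eigenvalues f)`_k.-1.

End Eigenvalues.

Section Boundary.
Variables (R : realType) (G : weightedGraphWithBoundary R).

Definition interior : {set G} := ~: boundary G.

Definition interior_laplacian : 'End({ffun induced_subgraph interior -> R^o}) :=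
  laplacian (induced_subgraph interior).

Definition boundary_deg (x : G) : R :=
  (vmeasure x)^-1 * \sum_(y in boundary G) weight x y.

(* Numbered from 1, in nondecreasing order. *)
Definition boundary_deg_nth (k : nat) : R :=
  (sort <=%R [seq boundary_deg x | x in interior])`_k.-1.

End Boundary.

(* Main.v *)
(* For u supported in the interior, <Delta u, u> exceeds <Delta_Omega u, u> by *)
(* the sum of Deg_B(x) u(x)^2 m_x. On the span of the first i + j              *)
(* eigenfunctions of Delta_Omega the interior form is at most                  *)
(* mu_(i+j)(Omega) |u|^2, and the functions of that span that vanish at the    *)
(* (at most j) vertices where Deg_B exceeds its (|Omega| - j)-th value form a  *)
(* subspace of dimension at least i on which the extra sum is at most that     *)
(* value times |u|^2; the min-max principle for Delta concludes.               *)
From HB Require Import structures.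
Require Import Defs.
From mathcomp Require Import all_boot all_order all_algebra.
From mathcomp Require Import reals.
From mathcomp Require complex.
From mathcomp Require Import ring lra zify.

Set Implicit Arguments.
Unset Strict Implicit.
Unset Printing Implicit Defensive.

Import Order.TTheory GRing.Theory Num.Theory.
Local Open Scope ring_scope.

(** Extending an interior function by zero keeps its norm and adds to its Dirichlet energy only the
    cost of the edges into the boundary, which is [boundary_deg] acting as a potential
    ([laplacian_zero_ext_dot]). That potential is at most its (|Omega| - j)-th value except at no
    more than j vertices ([card_boundary_deg_gt]). Vanishing there costs at most j dimensions
    ([dim_vanish_on]), which is why the interior eigenvalue has index i + j while the conclusion
    concerns the i-th eigenvalue of Delta. The passage between eigenvalues and subspaces rests on
    the two halves of min-max, [exists_rayleigh_le] and [eigenvalue_nth_le_rayleigh]. Both use that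
    eigenspaces of a self-adjoint map are orthogonal and span the space ([sum_leigenspace_full]);
    the eigenvectors needed for this come from complex eigenvalues of real matrices. *)

(** * Complex eigenvalues seen as real invariant subspaces *)

Section RealInvariantPlane.
Import complex.
Local Open Scope complex_scope.
Variable R : rcfType.

(** The characteristic polynomial has a complex root a + ib; x and y are the real and imaginary
    parts of an eigenvector for it. *)
Lemma mx_invariant_plane n (M : 'M[R]_n) : (0 < n)%N ->
  exists (a b : R) (x y : 'rV_n), [/\ (x != 0) || (y != 0),
    x *m M = a *: x - b *: y & y *m M = b *: x + a *: y].
Proof.
move=> n_gt0; have /closed_rootP[c] :
    size (char_poly (map_mx (real_complex R) M)) != 1%N.
  by rewrite size_char_poly eqSS -lt0n.
rewrite -eigenvalue_root_char => /eigenvalueP[z zM z0].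
pose x := map_mx (@Re R) z; pose y := map_mx (@Im R) z.
exists (Re c), (Im c), x, y; split.
- apply: contraNT z0; rewrite negb_or !negbK => /andP[/eqP x0 /eqP y0].
  apply/eqP/matrixP => i j; move/matrixP/(_ i j): x0; move/matrixP/(_ i j): y0.
  by rewrite !mxE => im0 re0; apply/eqP; rewrite eq_complex re0 im0 !eqxx.
- apply/rowP => l; move/matrixP/(_ ord0 l)/(congr1 (@Re R)): zM; rewrite !mxE.
  (* The cast to [Rcomplex R] views the complex numbers as a real vector space, on which [Re] is
     linear. *)
  rewrite (raddf_sum (@Re R : Rcomplex R -> R)).
  case: c => a b /=; case: (z _ l) => p q /= <-; apply: eq_bigr => j _.
  by rewrite !mxE; case: (z _ j) => s t /=; rewrite mulr0 subr0.
- apply/rowP => l; move/matrixP/(_ ord0 l)/(congr1 (@Im R)): zM; rewrite !mxE.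
  rewrite (raddf_sum (@Im R : Rcomplex R -> R)) addrC.
  case: c => a b /=; case: (z _ l) => p q /= <-; apply: eq_bigr => j _.
  by rewrite !mxE; case: (z _ j) => s t /=; rewrite mulr0 add0r.
Qed.

End RealInvariantPlane.

Import passmx.

Lemma lfun_invariant_plane (R : rcfType) (vT : vectType R) (f : 'End(vT))
    (K : {vspace vT}) : (f @: K <= K)%VS -> K != 0%VS ->
  exists (a b : R) (u v : vT), [/\ u \in K, v \in K, (u != 0) || (v != 0),
    f u = a *: u - b *: v & f v = b *: u + a *: v].
Proof.
(* [g] is the restriction of [f] to [K], an endomorphism thanks to the stability of [K]; the matrix
   result applies to it in a basis. *)
move=> fK K0; pose g := (linfun (vsproj K) \o f \o linfun (@vsval _ _ K))%VF.
have gE (w : subvs_of K) : vsval (g w) = f (vsval w).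
  rewrite !comp_lfunE !lfunE /= vsprojK //.
  by apply: (subvP fK); rewrite memv_img// subvsP.
have eb := vbasisP {:subvs_of K}; set e := vbasis _ in eb.
have [|a [b [x [y [xy0 xM yM]]]]] := mx_invariant_plane (mxof e e g).
  by rewrite dimvf /dim /= lt0n dimv_eq0.
have vecE k l z t : vsval (vecof e (k *: z + l *: t)) =
    k *: vsval (vecof e z) + l *: vsval (vecof e t).
  rewrite vecof_linear -[l *: t]addr0 vecof_linear !raddf0 addr0.
  by rewrite linearP linearZ.
exists a, b, (vsval (vecof e x)), (vsval (vecof e y)); rewrite !subvsP.
split=> //.
- have val_eq0 (w : subvs_of K) : (vsval w == 0) = (w == 0).
    by rewrite -(inj_eq subvs_inj) linear0.
  by rewrite !val_eq0 !vecof_eq0.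
- by rewrite -gE (hom_vecof e eb) xM -!scaleNr vecE.
- by rewrite -gE (hom_vecof e eb) yM vecE.
Qed.

(** * Inner products and orthogonal complements *)

Record innerProduct (R : numDomainType) (vT : lmodType R) := InnerProduct {
  dot :> vT -> vT -> R;
  dotC : forall u v, dot u v = dot v u;
  dot_linear : forall v a u w, dot (a *: u + w) v = a * dot u v + dot w v;
  dot_gt0 : forall u, u != 0 -> 0 < dot u u
}.

Section InnerProductTheory.
Variables (R : numDomainType) (vT : lmodType R) (d : innerProduct vT).

Lemma dotDl u v w : d (u + v) w = d u w + d v w.
Proof. by rewrite -[u]scale1r dot_linear mul1r scale1r. Qed.

Lemma dotDr u v w : d w (u + v) = d w u + d w v.
Proof. by rewrite dotC dotDl !(dotC d w). Qed.

Lemma dot0l v : d 0 v = 0.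
Proof. by apply: (addrI (d 0 v)); rewrite -dotDl !addr0. Qed.

Lemma dot0r v : d v 0 = 0. Proof. by rewrite dotC dot0l. Qed.

Lemma dotZl a u v : d (a *: u) v = a * d u v.
Proof. by rewrite -[a *: u]addr0 dot_linear dot0l addr0. Qed.

Lemma dotZr a u v : d v (a *: u) = a * d v u.
Proof. by rewrite dotC dotZl dotC. Qed.

Lemma dotBl u v w : d (u - v) w = d u w - d v w.
Proof. by rewrite dotDl -scaleN1r dotZl mulN1r. Qed.

Lemma dot_eq0 u : (d u u == 0) = (u == 0).
Proof.
have [->|u0] := eqVneq u 0; first by rewrite dot0l eqxx.
by rewrite gt_eqF// dot_gt0.
Qed.

Lemma dot_ge0 u : 0 <= d u u.
Proof. by have [->|/(dot_gt0 d)/ltW//] := eqVneq u 0; rewrite dot0l. Qed.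

End InnerProductTheory.

Definition orth_coords (R : numFieldType) (vT : vectType R)
  (d : innerProduct vT) n (e : n.-tuple vT) (u : vT) : 'rV[R]_n :=
  \row_i d u e`_i.

Fact orth_coords_linear (R : numFieldType) (vT : vectType R)
  (d : innerProduct vT) n (e : n.-tuple vT) : linear (orth_coords d e).
Proof. by move=> a u v; apply/rowP => i; rewrite !mxE dot_linear. Qed.

HB.instance Definition _ (R : numFieldType) (vT : vectType R)
  (d : innerProduct vT) n (e : n.-tuple vT) :=
  GRing.isLinear.Build R vT 'rV[R]_n _ (orth_coords d e)
    (orth_coords_linear d e).

(** The kernel form gives the dimension bound by rank-nullity, with no need for an orthonormal
    basis. *)
Definition orthocompl (R : numFieldType) (vT : vectType R) (d : innerProduct vT)
  (W : {vspace vT}) : {vspace vT} := lker (linfun (orth_coords d (vbasis W))).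

Lemma orthocomplP (R : numFieldType) (vT : vectType R) (d : innerProduct vT)
    (W : {vspace vT}) u :
  reflect (forall w, w \in W -> d u w = 0) (u \in orthocompl d W).
Proof.
rewrite memv_ker lfunE; apply: (iffP eqP) => [u0 w Ww|uW] /=; last first.
  by apply/rowP => i; rewrite !mxE uW// vbasis_mem// mem_nth// size_tuple.
rewrite (coord_vbasis Ww); elim/big_ind: _ => [|x y xi yi|i _].
- by rewrite dot0r.
- by rewrite dotDr xi yi addr0.
- by move/rowP/(_ i): u0; rewrite !mxE dotZr => ->; rewrite mulr0.
Qed.

(** With trivial kernel, the products with a basis of [W] embed the whole space into a space of
    dimension [\dim W]. *)
Lemma orthocompl_eq0 (R : numFieldType) (vT : vectType R) (d : innerProduct vT)
    (W : {vspace vT}) : orthocompl d W = 0%VS -> W = fullv.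
Proof.
rewrite /orthocompl => W0; apply/eqP; rewrite eqEdim subvf /=.
rewrite -(limg_ker_dim (linfun (orth_coords d (vbasis W)))) W0 capv0 dimv0.
by rewrite add0n (leq_trans (dimvS (subvf _)))// dimvf dim_matrix mul1r.
Qed.

Lemma leigenspaceP (R : fieldType) (vT : vectType R) (f : 'End(vT)) a v :
  reflect (f v = a *: v) (v \in leigenspace f a).
Proof.
by rewrite memv_ker !lfun_simp /= subr_eq0; apply: eqP.
Qed.

Lemma ltn_count_le_nth disp (T : orderType disp) (x0 : T) (s : seq T) i :
  sorted <=%O s -> (i < size s)%N -> (i < count (<= nth x0 s i)%O s)%N.
Proof.
move=> ss lt_i; rewrite ltnNge; apply/negP => le_i.
have := @nth_count_gt _ _ (nth x0 s i) x0 s i ss.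
by rewrite le_i lt_i ltxx => /(_ isT).
Qed.

(** * Spectral theorem and min-max for a self-adjoint map *)

Section SelfAdjoint.
Variables (R : realType) (vT : vectType R) (d : innerProduct vT).
Variable f : 'End(vT).
Hypothesis f_selfadj : forall u v, d (f u) v = d u (f v).

Local Notation E r := (\sum_(a <- r) leigenspace f a)%VS.

Lemma leigenspace_orth a b u v : a != b ->
  u \in leigenspace f a -> v \in leigenspace f b -> d u v = 0.
Proof.
move=> ab /leigenspaceP fu /leigenspaceP fv; move: (f_selfadj u v).
rewrite fu fv dotZl dotZr => /eqP; rewrite -subr_eq0 -mulrBl mulf_eq0 subr_eq0.
by rewrite (negPf ab) => /eqP.
Qed.

Lemma sum_leigenspace_orth a r u v : a \notin r ->
  u \in leigenspace f a -> v \in E r -> d u v = 0.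
Proof.
move=> + ua; elim: r v => [|b r IH] v.
  by rewrite big_nil memv0 => _ /eqP ->; rewrite dot0r.
rewrite inE negb_or big_cons => /andP[ab ar] /memv_addP[x xb [y yr ->]].
by rewrite dotDr (leigenspace_orth ab ua xb) IH// addr0.
Qed.

Lemma sum_leigenspace_stable r v : v \in E r -> f v \in E r.
Proof.
elim: r v => [|b r IH] v.
  by rewrite big_nil !memv0 => /eqP ->; rewrite linear0.
rewrite big_cons => /memv_addP[x xb [y yr ->]].
rewrite linearD/= memv_add ?IH//; by have /leigenspaceP -> := xb; rewrite memvZ.
Qed.

(** Orthogonality makes the sum of eigenspaces direct, and each dimension is a multiplicity in
    [eigenvalues f]. *)
Lemma dim_sum_leigenspace r : uniq r ->
  \dim (E r) = count (mem r) (eigenvalues f).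
Proof.
have [_ ec] := eigenvaluesP f.
elim: r => [|a r IH] /=; first by rewrite big_nil dimv0 count_pred0.
move=> /andP[ar ur]; rewrite big_cons dimv_disjoint_sum.
  rewrite IH// -ec -count_predUI [X in (_ + X)%N](eq_count (a2 := pred0)).
    by rewrite count_pred0 addn0; apply: eq_count => b; rewrite !inE.
  by move=> b /=; case: eqVneq => //= ->; apply: negbTE.
apply/eqP; rewrite -subv0; apply/subvP => v /memv_capP[va vr].
by rewrite memv0 -(dot_eq0 d) (sum_leigenspace_orth ar va vr).
Qed.

(** Here [c a] is the squared norm of the component of [v] in the eigenspace of [a]; the cross terms
    vanish by orthogonality. *)
Lemma sum_leigenspace_dot r v : uniq r -> v \in E r ->
  exists c : R -> R, [/\ forall a, 0 <= c a, d v v = \sum_(a <- r) c a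
    & d (f v) v = \sum_(a <- r) a * c a].
Proof.
elim: r v => [|b r IH] v /=.
  rewrite big_nil memv0 => _ /eqP ->; exists (fun=> 0).
  by rewrite !big_nil linear0 dot0l.
move=> /andP[br ur]; rewrite big_cons => /memv_addP[x xb [y yr ->]].
have [c [c0 cy cfy]] := IH _ ur yr.
have xy := sum_leigenspace_orth br xb yr.
have xfy := sum_leigenspace_orth br xb (sum_leigenspace_stable yr).
have /leigenspaceP fx := xb.
have cE (F : R -> R -> R) :
    \sum_(a <- r) F a (if a == b then d x x else c a) = \sum_(a <- r) F a (c a).
  by apply: eq_big_seq => a ar; case: eqVneq ar => // ->; rewrite (negPf br).
exists (fun a => if a == b then d x x else c a); split=> [a||].
- by case: eqP => // _; apply: dot_ge0.
- rewrite big_cons eqxx (cE (fun _ t => t)) -cy.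
  by rewrite dotDl !dotDr (dotC d y x) xy addr0 add0r.
- rewrite big_cons eqxx (cE (fun a t => a * t)) -cfy.
  rewrite linearD/= dotDl !dotDr (dotC d (f y) x) xfy fx !dotZl xy.
  by rewrite mulr0 addr0 add0r.
Qed.

Lemma mem_eigenvalues a v : v != 0 -> v \in leigenspace f a ->
  a \in eigenvalues f.
Proof.
move=> v0 va; have [_ ec] := eigenvaluesP f.
rewrite -has_pred1 has_count ec lt0n dimv_eq0; apply: contraNneq v0 => a0.
by rewrite a0 memv0 in va.
Qed.

(* A complex eigenvalue a + ib yields real u, v with f u = a u - b v and       *)
(* f v = b u + a v; self-adjointness then reads b (|u|^2 + |v|^2) = 0.         *)
Lemma exists_eigenvector (K : {vspace vT}) : (f @: K <= K)%VS -> K != 0%VS ->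
  exists a u, [/\ u \in K, u != 0 & u \in leigenspace f a].
Proof.
move=> fK /(lfun_invariant_plane fK)[a [b [u [v [uK vK uv0 fu fv]]]]].
have b0 : b = 0.
  have := f_selfadj u v; rewrite fu fv dotBl dotDr !dotZl !dotZr => uv.
  have /eqP : b * (d u u + d v v) = 0 by lra.
  rewrite mulf_eq0 => /orP[/eqP//|].
  rewrite paddr_eq0 ?dot_ge0// !dot_eq0.
  by case/orP: uv0 => /negPf->; rewrite ?andbF.
move: fu fv; rewrite b0 !scale0r subr0 add0r.
move=> /leigenspaceP fu /leigenspaceP fv.
by case/orP: uv0 => [u0|v0]; [exists a, u | exists a, v].
Qed.

(** The orthogonal complement of the sum is stable under [f]. Were it nonzero, it would contain an
    eigenvector, which also lies in the sum and so is orthogonal to itself. *)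
Lemma sum_leigenspace_full : E (undup (eigenvalues f)) = fullv.
Proof.
apply: (orthocompl_eq0 (d := d)); set W := E _; apply/eqP; apply: contraT => K0.
have fK : (f @: orthocompl d W <= orthocompl d W)%VS.
  apply/subvP => _ /memv_imgP[u /orthocomplP uW ->].
  by apply/orthocomplP => w wW; rewrite f_selfadj uW// sum_leigenspace_stable.
have [a [u [/orthocomplP uW u0 ua]]] := exists_eigenvector fK K0.
suff uinW : u \in W by rewrite -(dot_eq0 d) uW ?eqxx in u0.
have aev : a \in undup (eigenvalues f).
  by rewrite mem_undup (mem_eigenvalues u0).
rewrite /W (bigD1_seq a) ?undup_uniq//=.
by rewrite -[u]addr0 memv_add// mem0v.
Qed.

Lemma size_eigenvalues : size (eigenvalues f) = \dim {:vT}.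
Proof.
rewrite -sum_leigenspace_full dim_sum_leigenspace ?undup_uniq//.
apply/esym/eqP; rewrite -all_count; apply/allP => a /=.
by rewrite mem_undup.
Qed.

(** The subspace is the sum of all eigenspaces up to the k-th eigenvalue; when that eigenvalue is
    repeated, its dimension may exceed k. *)
Lemma exists_rayleigh_le k : (0 < k <= \dim {:vT})%N ->
  exists2 U : {vspace vT}, (k <= \dim U)%N &
    forall u, u \in U -> d (f u) u <= eigenvalue_nth f k * d u u.
Proof.
move=> /andP[k0 kn]; set t := eigenvalue_nth f k.
pose r := [seq a <- undup (eigenvalues f) | a <= t].
have [es _] := eigenvaluesP f.
have ur : uniq r by rewrite filter_uniq ?undup_uniq.
exists (E r) => [|u ur'].
  rewrite dim_sum_leigenspace//.
  rewrite (@eq_in_count _ _ (<= t)) => [|a aev]; last first.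
    by rewrite /= mem_filter mem_undup aev andbT.
  rewrite -(prednK k0) ltn_count_le_nth// size_eigenvalues prednK//.
have [c [c0 -> ->]] := sum_leigenspace_dot ur ur'.
rewrite mulr_sumr !big_seq; apply: ler_sum => a.
by rewrite mem_filter => /andP[at' _]; rewrite ler_wpM2r.
Qed.

(** If the k-th eigenvalue exceeded [t], the eigenspaces above [t] would be too large to meet [U]
    trivially, yet on them the Rayleigh quotient is above [t]. *)
Lemma eigenvalue_nth_le_rayleigh k t (U : {vspace vT}) :
  (0 < k <= \dim U)%N -> (forall u, u \in U -> d (f u) u <= t * d u u) ->
  eigenvalue_nth f k <= t.
Proof.
move=> /andP[k0 kU] Ut; rewrite leNgt; apply/negP => t_lt.
pose r := [seq a <- undup (eigenvalues f) | t < a].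
have [es _] := eigenvaluesP f.
have ur : uniq r by rewrite filter_uniq ?undup_uniq.
(* Fewer than k eigenvalues are at most [t], since otherwise the k-th one, stored at index [k.-1],
   would be. *)
have dimr : (\dim {:vT} < \dim (E r) + k)%N.
  rewrite dim_sum_leigenspace// -size_eigenvalues.
  rewrite -(count_predC (mem r)) ltn_add2l ltnNge; apply/negP => kc.
  have := @nth_count_le _ _ t 0 (eigenvalues f) k.-1 es.
  rewrite prednK// (@eq_in_count _ _ (predC (mem r))) => [/(_ kc)|a aev].
    by rewrite leNgt t_lt.
  by rewrite /= mem_filter mem_undup aev andbT leNgt.
have : (0 < \dim (U :&: E r))%N.
  have := dimv_sum_cap U (E r); have := dimvS (subvf (U + E r)); lia.
rewrite lt0n dimv_eq0 -vpick0; set u := vpick _ => u0.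
have /memv_capP[uU uE] : u \in (U :&: E r)%VS by apply: memv_pick.
have [c [c0 du dfu]] := sum_leigenspace_dot ur uE.
have at_ge0 a : a \in r -> 0 <= (a - t) * c a.
  by rewrite mem_filter => /andP[ta _]; rewrite mulr_ge0// subr_ge0 ltW.
(* The sum is d (f u) u - t * d u u, nonpositive because u lies in [U], while its terms are
   nonnegative. All [c a] are then zero, which forces u = 0. *)
have : \sum_(a <- r | a \in r) (a - t) * c a == 0.
  rewrite eq_le sumr_ge0// andbT -big_seq.
  under eq_bigr do rewrite mulrBl.
  by rewrite sumrB -mulr_sumr -du -dfu subr_le0 Ut.
rewrite psumr_eq0// => /allP atc0; case/negP: u0; rewrite -(dot_eq0 d) du.
rewrite big_seq big1// => a ar; have := atc0 _ ar.
rewrite ar mulf_eq0 subr_eq0 /= => /orP[/eqP ta|/eqP//].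
by move: ar; rewrite mem_filter ta ltxx.
Qed.

End SelfAdjoint.

(** * The graph Laplacian as a self-adjoint map *)

Section GraphLaplacian.
Variables (R : realType) (G : weightedGraph R).
Local Notation fun_space := {ffun G -> R^o}.

Definition vdot (u v : fun_space) : R := \sum_x u x * v x * vmeasure x.

Fact vdotC u v : vdot u v = vdot v u.
Proof. by apply: eq_bigr => x _; rewrite (mulrC (u x)). Qed.

Fact vdot_linear v a u w : vdot (a *: u + w) v = a * vdot u v + vdot w v.
Proof.
rewrite mulr_sumr -big_split /=; apply: eq_bigr => x _.
by rewrite !ffunE /GRing.scale /= !mulrDl !mulrA.
Qed.

Fact vdot_gt0 u : u != 0 -> 0 < vdot u u.
Proof.
move=> u0; have sq_ge0 x : 0 <= u x * u x * vmeasure x.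
  by rewrite mulr_ge0 ?(ltW (vmeasure_gt0 x))// -expr2 sqr_ge0.
rewrite lt_def sumr_ge0// andbT; apply: contraNneq u0 => /eqP.
rewrite psumr_eq0// => /allP uu0; apply/eqP/ffunP => x.
have := uu0 x (mem_index_enum x); rewrite !mulf_eq0 orbb ffunE.
by rewrite (gt_eqF (vmeasure_gt0 x)) orbF => /eqP.
Qed.

Definition vertex_dot := InnerProduct vdotC vdot_linear vdot_gt0.

Lemma vertex_dotE u v : vertex_dot u v = \sum_x u x * v x * vmeasure x.
Proof. by []. Qed.

Lemma laplacian_dot u v : vertex_dot (laplacian G u) v =
  \sum_x \sum_y (u x - u y) * weight x y * v x.
Proof.
apply: eq_bigr => x _; rewrite laplacianE mulrC !mulrA.
by rewrite mulfV ?gt_eqF ?vmeasure_gt0// mul1r mulr_suml.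
Qed.

Lemma laplacian_selfadj u v :
  vertex_dot (laplacian G u) v = vertex_dot u (laplacian G v).
Proof.
rewrite [RHS](dotC vertex_dot) !laplacian_dot.
have split_sum (p q : fun_space) :
    \sum_x \sum_y (p x - p y) * weight x y * q x =
    \sum_x \sum_y p x * q x * weight x y - \sum_x \sum_y p y * q x * weight x y.
  rewrite -sumrB; apply: eq_bigr => x _; rewrite -sumrB; apply: eq_bigr => y _.
  by rewrite !mulrBl !(mulrAC _ (weight x y)).
rewrite !split_sum; congr (_ - _).
  by do 2!apply: eq_bigr => ? _; rewrite [u _ * _]mulrC.
rewrite exchange_big; do 2!apply: eq_bigr => ? _.
by rewrite weight_sym [u _ * _]mulrC.
Qed.

End GraphLaplacian.

(** * Extension by zero and vanishing conditions *)

Lemma sum_sig (V : nmodType) (T : finType) (A : {set T}) (F : T -> V) :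
  (forall x, x \notin A -> F x = 0) ->
  \sum_x F x = \sum_(z : {x | x \in A}) F (val z).
Proof.
move=> F0; rewrite (bigID (mem A)) /= [X in _ + X]big1 ?addr0//.
rewrite (reindex_omap (val : {x | x \in A} -> T) insub) => [|x xA]; last first.
  by rewrite insubT.
by apply: eq_bigl => z; rewrite valK eqxx (valP z).
Qed.

Section ZeroExtension.
Variables (R : fieldType) (T : finType) (A : {set T}).

Definition zero_ext (u : {ffun {x | x \in A} -> R^o}) : {ffun T -> R^o} :=
  [ffun x => oapp u 0 (insub x)].

Lemma zero_ext_val u z : zero_ext u (val z) = u z.
Proof. by rewrite ffunE valK. Qed.

Lemma zero_ext_out u x : x \notin A -> zero_ext u x = 0.
Proof. by move=> xA; rewrite ffunE insubN. Qed.

Fact zero_ext_linear : linear zero_ext.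
Proof.
move=> a u v; apply/ffunP => x; rewrite !ffunE.
by case: insub => [z|] /=; rewrite ?ffunE// scaler0 addr0.
Qed.

HB.instance Definition _ := GRing.isLinear.Build R
  {ffun {x | x \in A} -> R^o} {ffun T -> R^o} _ zero_ext zero_ext_linear.

Lemma dim_zero_ext (U : {vspace {ffun {x | x \in A} -> R^o}}) :
  \dim (linfun zero_ext @: U) = \dim U.
Proof.
apply: limg_dim_eq; rewrite (_ : lker _ = 0%VS) ?capv0//.
apply/eqP/lker0P => u v; rewrite !lfunE => /ffunP uv; apply/ffunP => z.
by have := uv (val z); rewrite !zero_ext_val.
Qed.

Definition values_on (u : {ffun T -> R^o}) : 'rV[R]_#|A| :=
  \row_k u (enum_val k).

Fact values_on_linear : linear values_on.
Proof. by move=> a u v; apply/rowP => k; rewrite !mxE !ffunE. Qed.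

HB.instance Definition _ := GRing.isLinear.Build R
  {ffun T -> R^o} 'rV[R]_#|A| _ values_on values_on_linear.

Definition vanish_on : {vspace {ffun T -> R^o}} := lker (linfun values_on).

Lemma vanish_onP u : u \in vanish_on -> forall x, x \in A -> u x = 0.
Proof.
rewrite memv_ker lfunE => /eqP/rowP u0 x xA.
by have := u0 (enum_rank_in xA x); rewrite !mxE enum_rankK_in.
Qed.

(** Vanishing on [A] imposes [#|A|] linear conditions, so rank-nullity on [U] bounds the loss. *)
Lemma dim_vanish_on (U : {vspace {ffun T -> R^o}}) :
  (\dim U <= \dim (U :&: vanish_on) + #|A|)%N.
Proof.
rewrite -(limg_ker_dim (linfun values_on) U) leq_add2l.
by rewrite (leq_trans (dimvS (subvf _)))// dimvf dim_matrix mul1r.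
Qed.

End ZeroExtension.

(** * Comparison of the two Laplacians *)

Section InteriorComparison.
Variables (R : realType) (G : weightedGraphWithBoundary R).
Local Notation n := #|interior G|.

Lemma laplacian_zero_ext_dot (u : {ffun induced_subgraph (interior G) -> R^o}) :
  vertex_dot G (laplacian G (zero_ext u)) (zero_ext u) =
  vertex_dot _ (interior_laplacian G u) u +
  \sum_x boundary_deg x * (zero_ext u x * zero_ext u x * vmeasure x).
Proof.
rewrite !laplacian_dot (sum_sig (A := interior G)) => [|x xA]; last first.
  by apply: big1 => y _; rewrite (zero_ext_out _ xA) mulr0.
rewrite [X in _ = _ + X](sum_sig (A := interior G)) => [|x xA]; last first.
  by rewrite (zero_ext_out _ xA) !mul0r mulr0.
rewrite -big_split; apply: eq_bigr => z _ /=.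
(* Interior neighbours give the interior form; a boundary neighbour y, where the extension is 0,
   contributes u(z)^2 times the weight of zy. *)
rewrite (bigID (mem (boundary G))) /= addrC; congr (_ + _).
  rewrite big_mkcond (sum_sig (A := interior G)) => [|x]; last first.
    by rewrite inE negbK => ->.
  apply: eq_bigr => z' _; have := valP z'; rewrite /= inE => ->.
  by rewrite !zero_ext_val.
rewrite /boundary_deg [RHS]mulrC !mulrA mulfK ?gt_eqF ?vmeasure_gt0// mulr_sumr.
apply: eq_bigr => y yB.
have yI : y \notin interior G by rewrite inE negbK.
by rewrite (zero_ext_out _ yI) subr0; ring.
Qed.

Lemma card_boundary_deg_gt j : (j < n)%N ->
  (#|[set x in interior G |
        boundary_deg_nth G (n - j) < boundary_deg x]%R| <= j)%N.
Proof.
move=> lt_j; set t := boundary_deg_nth _ _.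
set s := [seq boundary_deg x | x in interior G].
have size_s : size (sort <=%R s) = n by rewrite size_sort size_map cardE.
have : (n - j <= count (<= t) s)%N.
  rewrite -(permP (permEl (perm_sort <=%R s))).
  (* [t] sits at index n - j - 1 of the sorted list, so it bounds the first n - j entries; j < n
     keeps the predecessor from truncating. *)
  rewrite -[X in (X <= _)%N]prednK ?subn_gt0// ltn_count_le_nth//.
  by rewrite -/s size_s; lia.
have := count_predC (<= t) s; rewrite -[X in _ = X](size_sort <=%R) size_s.
suff -> : #|[set x in interior G | t < boundary_deg x]| =
    count (predC (<= t)) s.
  by lia.
rewrite -sum1_card -sum1_count big_map big_enum_cond.
by apply: eq_bigl => x; rewrite inE /= ltNge.
Qed.

End InteriorComparison.

Theorem corollary1p4 (R : realType) (G : weightedGraphWithBoundary R)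
    (i j : nat) (i_ge1 : (1 <= i)%N) (i_le : (i <= #|interior G|)%N)
    (j_le : (j <= #|interior G| - i)%N) :
  eigenvalue_nth (laplacian G) i <=
    eigenvalue_nth (interior_laplacian G) (i + j)
      + boundary_deg_nth G (#|interior G| - j).
Proof.
set l := eigenvalue_nth (interior_laplacian G) _; set t := boundary_deg_nth _ _.
have [|L dimL Ll] := @exists_rayleigh_le _ _ _ _
    (@laplacian_selfadj R (induced_subgraph (interior G))) (i + j).
  rewrite dimvf /dim /= card_sig.
  have -> : #|[pred x in interior G]| = #|interior G| by apply: eq_card.
  by rewrite (_ : dim _ = 1%N)//; lia.
pose Z := [set x in interior G | t < boundary_deg x].
pose U := (linfun (@zero_ext R G (interior G)) @: L :&: vanish_on R Z)%VS.
apply: (eigenvalue_nth_le_rayleigh (@laplacian_selfadj R G) (U := U)) => [|w].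
  rewrite i_ge1 -(leq_add2r j) (leq_trans dimL)// -dim_zero_ext.
  rewrite (leq_trans (dim_vanish_on Z _))// leq_add2l card_boundary_deg_gt//.
  by lia.
case/memv_capP=> /memv_imgP[u uL ->{w}]; rewrite lfunE => /vanish_onP uZ.
rewrite laplacian_zero_ext_dot mulrDl lerD//.
  rewrite (le_trans (Ll _ uL))// !vertex_dotE.
  rewrite [X in _ <= _ * X](sum_sig (A := interior G)) => [|x xA].
    by under [X in _ <= _ * X]eq_bigr do rewrite !zero_ext_val.
  by rewrite (zero_ext_out _ xA) !mul0r.
rewrite vertex_dotE mulr_sumr; apply: ler_sum => x _.
(* The bound holds vertex by vertex: the function is 0 on [Z] and on the boundary, and elsewhere
   [boundary_deg] is at most [t]. *)
have [xZ|xNZ] := boolP (x \in Z); first by rewrite uZ// !mul0r !mulr0.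
have [xI|/zero_ext_out ->] := boolP (x \in interior G); last first.
  by rewrite !mul0r !mulr0.
rewrite ler_wpM2r//; last by move: xNZ; rewrite inE xI -leNgt.
by rewrite -expr2 mulr_ge0 ?sqr_ge0// ltW ?vmeasure_gt0.
Qed.
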